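(* Let $K$ be a field, let $n\geq 3$, and let $C_n$ be the cycle of length $n$. Then $\mathrm{v}(J(C_n))=\lfloor \frac{n}{2}\rfloor$. Moreover, $\mathrm{v}(J(C_n))\leq \alpha_0(C_n)$, and thus, for $n\neq 4$, we have $\mathrm{v}(J(C_n))\leq \mathrm{bight}(I(C_n))-1$.
   Context: $C_n$ is the simple graph with vertex set $\{x_1,\ldots,x_n\}$ and edge set $\{\{x_i,x_{i+1}\} : 1\le i\le n\}$, where $x_{n+1}=x_1$. For a finite simple graph $G$ with vertex set $V(G)=\{x_1,\ldots,x_n\}$, let $R=K[x_1,\ldots,x_n]=\bigoplus_{d\ge 0}R_d$ with the standard grading. The edge ideal of $G$ is $I(G)=\langle x_ix_j : \{x_i,x_j\}\in E(G)\rangle\subseteq R$. A vertex cover of $G$ is a set $C\subseteq V(G)$ meeting every edge; it is minimal if it is minimal under inclusion. $\alpha_0(G)$ denotes the minimum cardinality of a vertex cover of $G$. $\mathrm{bight}(I(G))$ (big height) is the maximum height of an associated prime of $I(G)$; it equals the maximum cardinality of a minimal vertex cover of $G$. For $C\subseteq V(G)$ put $X_C=\prod_{x_i\in C}x_i$. The cover ideal of $G$ is $J(G)=\langle X_C : C \text{ a minimal vertex cover of } G\rangle=\bigcap_{\{x_i,x_j\}\in E(G)}\langle x_i,x_j\rangle$. For a proper graded ideal $I\subseteq R$, the $\mathrm{v}$-number is $\mathrm{v}(I)=\min\{d\ge 0 : \text{there exist } f\in R_d \text{ and } \mathfrak p\in \mathrm{Ass}(I) \text{ with } I:f=\mathfrak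 p\}$, where $\mathrm{Ass}(I)$ is the set of associated primes of $I$ (i.e. of $R/I$). *)

(* Defs.v *)
From mathcomp Require Import all_boot all_order all_algebra.
From mathcomp Require Import mpoly.
From Stdlib Require Import ClassicalEpsilon.

Set Implicit Arguments.
Unset Strict Implicit.
Unset Printing Implicit Defensive.

Import GRing.Theory.

(* Least and greatest element of a set of natural numbers; the value is
   unspecified when the set has no least (resp. greatest) element. *)
Definition nat_min (P : nat -> Prop) : nat :=
  epsilon (inhabits 0) (fun d => P d /\ forall m, P m -> d <= m).

Definition nat_max (P : nat -> Prop) : nat :=
  epsilon (inhabits 0) (fun d => P d /\ forall m, P m -> m <= d).

Section Ideals.

Local Open Scope ring_scope.

Variable R : comNzRingType.

(* Subsets of R are Prop-valued: the ideals of ring_quotient are boolean and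
   proper, whereas membership in a generated ideal or in I : f is neither
   given by a boolean nor restricted to proper ideals. *)
Implicit Types I J P Q S : R -> Prop.

Definition set_eq I J : Prop := forall g, I g <-> J g.

Definition set_proper I J : Prop :=
  (forall g, I g -> J g) /\ exists2 g, J g & ~ I g.

Definition is_ideal I : Prop :=
  [/\ I 0, forall f g, I f -> I g -> I (f + g) & forall r f, I f -> I (r * f)].

Definition is_prime_ideal P : Prop :=
  [/\ is_ideal P, ~ P 1 & forall f g, P (f * g) -> P f \/ P g].

Definition ideal_gen S : R -> Prop :=
  fun f => forall I, is_ideal I -> (forall g, S g -> I g) -> I f.

Definition colon I (f : R) : R -> Prop := fun g => I (g * f).

Definition associated_prime I P : Prop :=
  is_prime_ideal P /\ exists f, set_eq (colon I f) P.

(* There is a strict chain P_0 < ... < P_h = P of prime ideals. *)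
Definition prime_chain P (h : nat) : Prop :=
  exists Q : nat -> R -> Prop,
    [/\ forall i, (i <= h)%N -> is_prime_ideal (Q i),
        forall i, (i < h)%N -> set_proper (Q i) (Q i.+1)
      & set_eq (Q h) P].

Definition height P : nat := nat_max (prime_chain P).

Definition bight I : nat :=
  nat_max (fun h => exists2 P, associated_prime I P & h = height P).

End Ideals.

Definition v_number (K : fieldType) (n : nat) (I : {mpoly K[n]} -> Prop) : nat :=
  nat_min (fun d => exists f : {mpoly K[n]}, exists P : {mpoly K[n]} -> Prop,
    [/\ f \is d.-homog, associated_prime I P & set_eq (colon I f) P]).

(* A graph on the vertices 'I_n is given by its set of edges. *)
Definition simple_graph (n : nat) (E : {set {set 'I_n}}) : Prop :=
  forall e, e \in E -> #|e| = 2.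

Definition vertex_cover (n : nat) (E : {set {set 'I_n}}) (C : {set 'I_n}) : bool :=
  [forall e in E, C :&: e != set0].

(* The whole vertex set is a cover as soon as all edges are nonempty. *)
Definition alpha0 (n : nat) (E : {set {set 'I_n}}) : nat :=
  #|[arg min_(C < [set: 'I_n] | vertex_cover E C) #|C|]|.

Section GraphIdeals.

Local Open Scope ring_scope.

Variables (K : fieldType) (n : nat) (E : {set {set 'I_n}}).

Definition edge_ideal : {mpoly K[n]} -> Prop :=
  ideal_gen (fun f => exists i j : 'I_n, [set i; j] \in E /\ f = 'X_i * 'X_j).

Definition cover_ideal : {mpoly K[n]} -> Prop :=
  ideal_gen (fun f => exists2 C : {set 'I_n},
    minset (vertex_cover E) C & f = \prod_(i in C) 'X_i).

End GraphIdeals.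

Arguments edge_ideal K {n} E _.
Arguments cover_ideal K {n} E _.

(* ordS is the cyclic successor, so that n - 1 is followed by 0. *)
Definition cycle_graph (n : nat) : {set {set 'I_n}} :=
  [set [set i; ordS i] | i : 'I_n].

Lemma cycle_graph_simple (n : nat) : 2 < n -> simple_graph (cycle_graph n).
Proof.
move=> n_gt2 _ /imsetP[i _ ->]; rewrite cards2.
case: eqP => // /(congr1 val) /= /esym.
have [in_lt|] := ltnP i.+1 n; first by rewrite modn_small // => /eqP; rewrite gtn_eqF.
move=> n_le; have -> : i.+1 = n by apply/eqP; rewrite eqn_leq n_le ltn_ord.
by rewrite modnn => i0; move: n_le; rewrite -i0 leqNgt (ltn_trans _ n_gt2).
Qed.

Lemma vertex_coverT (n : nat) (E : {set {set 'I_n}}) :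
  simple_graph E -> vertex_cover E [set: 'I_n].
Proof.
move=> sE; apply/forall_inP => e /sE e2.
by rewrite setTI -card_gt0 e2.
Qed.

(* Main.v *)
(* The edge and cover ideals are determined by the supports of the monomials of
   their elements, and the ideals generated by a set of variables are prime.

   If J : f is prime, it contains both variables of some edge e, and the support
   of any monomial of f covers all edges but e; each vertex lies on two edges,
   so this support has at least (n - 1) / 2 elements.  A squarefree monomial
   whose support covers everything but e, avoids e and has floor(n / 2) elements
   attains the bound.

   For n <> 4 a minimal cover avoiding the vertices i and i + 3 contains both
   i + 1 and i + 2, hence has more than n / 2 elements; it generates an
   associated prime of the edge ideal, of height at least its size.  That big
   height is a genuine maximum requires the height of primes to be bounded, i.e.
   dim K[x_1, ..., x_n] <= n, proved as follows: if Q_0 < ... < Q_h is a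
   chain of primes and x_i is in Q_(i+1) but not in Q_i, the monomials in the
   x_i are linearly independent modulo Q_0, whereas n + 1 polynomials in n
   variables are algebraically dependent by counting dimensions. *)

Require Import Defs.
From mathcomp Require Import all_boot all_order all_algebra.
From mathcomp Require Import mpoly.
From mathcomp Require Import zify.
From Stdlib Require Import ClassicalEpsilon.

Set Implicit Arguments.
Unset Strict Implicit.
Unset Printing Implicit Defensive.

Import GRing.Theory.

(** * Least and greatest elements of sets of naturals *)

Section NatExtrema.

Lemma nat_minP (P : nat -> Prop) d :
  P d -> (forall m, P m -> d <= m) -> nat_min P = d.
Proof.
move=> Pd mind; have /(epsilon_spec (inhabits 0))[Pe mine] :
  exists e, P e /\ forall m, P m -> e <= m by exists d.
by apply/eqP; rewrite eqn_leq mine ?mind.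
Qed.

(** The bound [b] provides a greatest element: it is lowered until it is attained, by excluded
    middle. *)
Lemma nat_maxP (P : nat -> Prop) d b :
    P d -> (forall m, P m -> m <= b) ->
  P (nat_max P) /\ forall m, P m -> m <= nat_max P.
Proof.
move=> Pd leb; apply: (epsilon_spec _ (fun d => P d /\ forall m, P m -> m <= d)).
elim: b leb => [|b IHb] leb.
  by exists d; split=> // m /leb; rewrite leqn0 => /eqP->.
have [Pb | nPb] := classic (P b.+1); first by exists b.+1.
apply: IHb => m Pm; have := leb m Pm; rewrite leq_eqVlt => /predU1P[mb|//].
by case: nPb; rewrite -mb.
Qed.

End NatExtrema.

(** * Ideals and primes in a commutative ring *)

Section Ideals.

Local Open Scope ring_scope.

Variable R : comNzRingType.
Implicit Types I P : R -> Prop.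

Lemma ideal_sum I (T : Type) (r : seq T) (p : pred T) (F : T -> R) :
  is_ideal I -> (forall t, p t -> I (F t)) -> I (\sum_(t <- r | p t) F t).
Proof. by case=> I0 ID _ IF; elim/big_ind: _. Qed.

Lemma idealB I f g : is_ideal I -> I f -> I g -> I (f - g).
Proof. by case=> _ ID IM If Ig; apply: ID => //; rewrite -mulN1r; apply: IM. Qed.

Lemma prime_ideal_prod P (T : Type) (r : seq T) (p : pred T) (F : T -> R) :
    is_prime_ideal P -> P (\prod_(t <- r | p t) F t) ->
  exists2 t, p t & P (F t).
Proof.
move=> [_ P1 PM]; elim: r => [|t r IHr]; first by rewrite big_nil.
rewrite big_cons; case: ifP => // pt /PM[PFt | /IHr //]; by exists t.
Qed.

Lemma prime_idealX P (x : R) k : is_prime_ideal P -> P (x ^+ k) -> P x.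
Proof.
by move=> [_ P1 PM]; elim: k => // k IHk; rewrite exprS => /PM[].
Qed.

End Ideals.

(** * Squarefree monomial ideals and primes generated by variables *)

Section MonomialIdeals.

Local Open Scope ring_scope.

Variables (K : fieldType) (n : nat).
Implicit Types (m : 'X_{1..n}) (A C D S : {set 'I_n}) (f g : {mpoly K[n]}).
Implicit Types (U V : pred {set 'I_n}).

Definition mvars m : {set 'I_n} := [set i | m i != 0%N].

Lemma mvarsD m1 m2 : mvars (m1 + m2)%MM = mvars m1 :|: mvars m2.
Proof. by apply/setP=> i; rewrite !inE mnmDE addn_eq0 negb_and. Qed.

Lemma mvars_mesym1 C : mvars (mesym1 C) = C.
Proof. by apply/setP=> i; rewrite inE mnmE; case: (i \in C). Qed.

Lemma leq_card_mvars m : (#|mvars m| <= mdeg m)%N.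
Proof.
rewrite mdegE -sum1_card big_mkcond; apply: leq_sum => i _.
by rewrite inE; case: (m i).
Qed.

Lemma mesym1_le C m : C \subset mvars m -> (mesym1 C <= m)%MM.
Proof.
move/subsetP=> Cm; apply/mnm_lepP=> i; rewrite mnmE.
by case: (boolP (i \in C)) => // /Cm; rewrite inE lt0n.
Qed.

Lemma mpolyX_mesym1 C : 'X_[K, mesym1 C] = \prod_(i in C) 'X_i.
Proof.
rewrite mprodXE; congr 'X_[_]; apply/mnmP=> j; rewrite mnmE mnm_sumE.
rewrite (eq_bigr (fun i => (i == j) : nat)) => [|i _]; last by rewrite mnmE.
case: (boolP (j \in C)) => [jC | njC].
  by rewrite (bigD1 j) //= eqxx big1 // => i /andP[_ /negbTE->].
rewrite big1 // => i iC; by case: eqP => // ij; rewrite -ij iC in njC.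
Qed.

(** For up-closed [U], this is the squarefree monomial ideal spanned by the monomials with support
    in [U]. *)
Definition support_ideal U f : Prop := {in msupp f, forall m, U (mvars m)}.

Definition up_closed U : Prop := forall A C, A \subset C -> U A -> U C.

Lemma support_ideal_ideal U : up_closed U -> is_ideal (support_ideal U).
Proof.
move=> upU; split=> [m|f g Uf Ug m|r f Uf m]; first by rewrite msupp0.
  by move/msuppD_le; rewrite mem_cat => /orP[/Uf | /Ug].
case/msuppM_le/allpairsP=> -[m1 m2] /= [_ /Uf Um2 ->].
by rewrite mvarsD; apply: upU Um2; apply: subsetUr.
Qed.

Lemma support_idealX U m : support_ideal U 'X_[m] <-> U (mvars m).
Proof.
split=> [-> //|Um m']; first by rewrite msuppX mem_seq1.
by rewrite msuppX mem_seq1 => /eqP->.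
Qed.

Lemma support_ideal_gen U (S : {mpoly K[n]} -> Prop) :
    up_closed U ->
    (forall g, S g -> exists2 C, U C & g = 'X_[mesym1 C]) ->
    (forall D, U D -> exists2 C : {set _}, C \subset D & S 'X_[mesym1 C]) ->
  set_eq (ideal_gen S) (support_ideal U).
Proof.
move=> upU SU US f; split=> [|Uf I idI IS].
  apply; first exact: support_ideal_ideal.
  by move=> _ /SU[C UC ->]; apply/support_idealX; rewrite mvars_mesym1.
have [_ _ IM] := idI; rewrite [f]mpolyE big_seq.
apply: ideal_sum => // m /Uf /US[C /mesym1_le Cm /IS IC].
by rewrite -mul_mpolyC -(submK Cm) mpolyXD mulrA; apply: IM.
Qed.

(** Describes the colon by a monomial: multiplication by ['X_[m]] shifts the monomials of [f]
    injectively and enlarges each support by that of [m]. *)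
Lemma support_ideal_mulX U f m :
  support_ideal U (f * 'X_[m]) <->
  {in msupp f, forall m', U (mvars m' :|: mvars m)}.
Proof.
split=> Uf m'.
  move=> m'f; rewrite setUC -mvarsD; apply: Uf.
  by rewrite (perm_mem (msuppMX f m)) map_f.
rewrite (perm_mem (msuppMX f m)) => /mapP[m1 m1f ->].
by rewrite mvarsD setUC; apply: Uf.
Qed.

(** [support_ideal (meets A)] is the ideal generated by the variables in [A]. *)
Definition meets A : pred {set 'I_n} := fun D => D :&: A != set0.

Lemma meets_up A : up_closed (meets A).
Proof.
by move=> C D sCD; rewrite /meets -!card_gt0 => /leq_trans->//; rewrite subset_leq_card ?setSI.
Qed.

Lemma meetsP A D : reflect (exists2 i, i \in D & i \in A) (meets A D).
Proof.
apply: (iffP (set0Pn _)) => [[i /setIP[]] | [i iD iA]]; exists i => //.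
by rewrite inE iD.
Qed.

(** Substituting this tuple is a ring morphism into a domain with kernel [support_ideal (meets A)],
    whence primality. *)
Definition kill_vars A : n.-tuple {mpoly K[n]} :=
  [tuple if i \in A then 0 else 'X_i | i < n].

Lemma kill_varsX A m :
  'X_[m] \mPo kill_vars A = if meets A (mvars m) then 0 else 'X_[m].
Proof.
rewrite comp_mpolyX; case: meetsP => [[i im iA]|noA].
  rewrite (bigD1 i) //= tnth_mktuple iA expr0n.
  by move: im; rewrite inE => /negbTE->; rewrite mul0r.
rewrite mpolyXE_id; apply: eq_bigr => i _; rewrite tnth_mktuple.
case: ifP => // iA; case: (eqVneq (m i) 0%N) => [->|mi]; first by rewrite !expr0.
by case: noA; exists i; rewrite ?inE.
Qed.

Lemma kill_vars_coef A f m :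
  (f \mPo kill_vars A)@_m = if meets A (mvars m) then 0 else f@_m.
Proof.
rewrite comp_mpolyEX raddf_sum /= [in RHS](mpolyE f) raddf_sum /=.
case: ifP => mA; [apply: big1 | apply: eq_bigr] => m' _;
  rewrite !mcoeffZ kill_varsX; case: ifP => m'A; rewrite ?mcoeff0 ?mulr0 //.
- rewrite mcoeffX; case: eqP => [m'm|]; last by rewrite mulr0.
  by rewrite -m'm m'A in mA.
- rewrite mcoeffX; case: eqP => [m'm|]; last by rewrite mulr0.
  by rewrite -m'm m'A in mA.
Qed.

Lemma support_meetsE A f :
  support_ideal (meets A) f <-> f \mPo kill_vars A = 0.
Proof.
split=> [Af | f0 m].
  apply/mpolyP=> m; rewrite kill_vars_coef mcoeff0; case: ifPn => // nA.
  by apply/eqP; rewrite mcoeff_eq0; apply: contra nA => /Af.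
rewrite mcoeff_msupp; apply: contraR => nA.
have /mpolyP/(_ m) := f0.
by rewrite kill_vars_coef (negbTE nA) mcoeff0 => /eqP.
Qed.

Lemma support_meets_prime A : is_prime_ideal (support_ideal (meets A)).
Proof.
split; first exact/support_ideal_ideal/meets_up.
  by move/support_meetsE/eqP; rewrite rmorph1 oner_eq0.
move=> f g /support_meetsE/eqP; rewrite rmorphM mulf_eq0.
by case/orP=> /eqP/support_meetsE; [left | right].
Qed.

(** The first [k] variables of [enum A] generate the [k]-th prime; the next variable witnesses
    strictness. *)
Lemma support_meets_chain A :
  prime_chain (support_ideal (meets A)) #|A|.
Proof.
pose B k := [set i in take k (enum A)].
have size_A : size (enum A) = #|A| by rewrite -cardE.
exists (fun k => support_ideal (meets (B k))).
split=> [k _|k kA|f]; first exact: support_meets_prime.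
  have sB : B k \subset B k.+1.
    apply/subsetP=> i; rewrite !inE => ik.
    rewrite (take_nth (enum_val (Ordinal kA))) ?size_A //.
    by rewrite mem_rcons inE ik orbT.
  split=> [f Bf m /Bf/meetsP[i im iB]|].
    by apply/meetsP; exists i => //; apply: subsetP iB.
  have i0 : 'I_n := enum_val (Ordinal kA).
  exists 'X_(nth i0 (enum A) k).
    apply/support_idealX/meetsP; exists (nth i0 (enum A) k).
      by rewrite inE mnmE eqxx.
    by rewrite inE (take_nth i0) ?size_A // mem_rcons mem_head.
  move/support_idealX/meetsP=> [i]; rewrite inE mnmE eqb0 negbK => /eqP <-.
  rewrite inE => ik.
  have := enum_uniq A; rewrite -(cat_take_drop k (enum A)).
  rewrite (drop_nth i0) ?size_A // cat_uniq => /and3P[_ /hasPn/(_ _ (mem_head _ _))].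
  by rewrite /= ik.
have -> : B #|A| = A; last by [].
by apply/setP=> i; rewrite inE -size_A take_size mem_enum.
Qed.

End MonomialIdeals.

(** * Chains of primes have length at most the number of variables *)

Section Dimension.

Local Open Scope ring_scope.

Variables (K : fieldType) (n : nat).

Lemma msize_prod_leq (I : Type) (r : seq I) (d : I -> nat)
    (F : I -> {mpoly K[n]}) :
  (forall i, (msize (F i) <= (d i).+1)%N) ->
  (msize (\prod_(i <- r) F i) <= (\sum_(i <- r) d i).+1)%N.
Proof.
move=> Fd; elim/big_rec2: _ => [|i s p _ ps]; first by rewrite msize1.
have [->|nzF] := eqVneq (F i) 0; first by rewrite mul0r msize0.
have [->|nzp] := eqVneq p 0; first by rewrite mulr0 msize0.
by rewrite msizeM // -subn1 leq_subLR add1n -addnS -addSn leq_add.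
Qed.

Lemma msize_exp_leq (f : {mpoly K[n]}) d k :
  (msize f <= d.+1)%N -> (msize (f ^+ k) <= (k * d).+1)%N.
Proof.
move=> fd; have := @msize_prod_leq _ (index_iota 0 k) (fun=> d) (fun=> f) (fun=> fd).
by rewrite prodr_const_nat sum_nat_const_nat subn0.
Qed.

(** Only monomials with all exponents below [M] occur, so the coefficient matrix has [M ^ n] columns
    and more rows; a vector of its left kernel gives [c]. *)
Lemma mpoly_lin_dep (T : finType) (p : T -> {mpoly K[n]}) M :
    (forall t, (msize (p t) <= M)%N) -> (M ^ n < #|T|)%N ->
  exists2 c : T -> K, (exists t, c t != 0) & \sum_t c t *: p t = 0.
Proof.
move=> pM ltT; pose B := {ffun 'I_n -> 'I_M}.
pose A := \matrix_(a < #|T|, b < #|{: B}|)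
  (p (enum_val a))@_[multinom (enum_val b i : nat) | i < n].
have : kermx A != 0.
  rewrite kermx_eq0 /row_free neq_ltn (leq_ltn_trans (rank_leq_col A)) //.
  by rewrite card_ffun !card_ord.
rewrite -nz_row_eq0; set v := nz_row _ => nzv.
have vA : v *m A = 0 by apply/sub_kermxP/nz_row_sub.
exists (fun t => v 0 (enum_rank t)).
  case/rV0Pn: nzv => a va; by exists (enum_val a); rewrite enum_valK.
apply/mpolyP=> m; rewrite raddf_sum mcoeff0 /=.
case: (leqP M (mdeg m)) => [leM | ltM].
  rewrite big1 // => t _; rewrite mcoeffZ (memN_msupp_eq0 (msize_mdeg_ge _)) ?mulr0 //.
  exact: leq_trans (pM t) leM.
have mM i : (m i < M)%N.
  by apply: leq_ltn_trans ltM; rewrite mdegE (bigD1 i) //= leq_addr.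
pose b : B := [ffun i => Ordinal (mM i)].
have /rowP/(_ (enum_rank b)) := vA; rewrite !mxE => vAb.
rewrite -[RHS]vAb [RHS](reindex _ (onW_bij _ (enum_rank_bij T))) /=.
apply: eq_bigr => t _; rewrite mcoeffZ !mxE !enum_rankK; congr (_ * _@__).
by apply/mnmP=> i; rewrite mnmE ffunE.
Qed.

Lemma mpoly_alg_dep (x : nat -> {mpoly K[n]}) :
  exists N, exists2 c : {ffun 'I_n.+1 -> 'I_N} -> K,
    (exists t, c t != 0) & \sum_t c t *: \prod_(j < n.+1) x j ^+ t j = 0.
Proof.
pose D := (\max_(j < n.+1) msize (x j))%N.
(* The products have size at most [N * (n.+1 * D).+1], and this [N] makes the [n]-th power of that
   bound smaller than [N ^ n.+1], the number of products. *)
pose N := ((n.+1 * D).+1 ^ n).+1.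
exists N; apply: (@mpoly_lin_dep _ _ (n.+1 * (N * D)).+1) => [t|].
  apply: leq_trans (@msize_prod_leq _ _ (fun=> (N * D)%N) _ _) _ => [j|].
    apply: leq_trans (@msize_exp_leq _ D _ _) _.
      by apply/leqW/(@leq_bigmax _ (fun j : 'I_n.+1 => msize (x j))).
    by rewrite ltnS leq_mul2r (ltnW (ltn_ord _)) orbT.
  by rewrite sum_nat_const card_ord.
rewrite card_ffun !card_ord expnSr.
apply: (@leq_ltn_trans ((N * (n.+1 * D).+1) ^ n)).
  case: (posnP n) => [->|n0] //; rewrite leq_exp2r //.
  by rewrite mulnS mulnCA -add1n leq_add.
by rewrite expnMn ltn_pmul2l ?expn_gt0.
Qed.

(* Among the terms compare the exponents of [x i] with the smallest one, [k]:
   dividing by [x i ^+ k] leaves, modulo [x i], only the terms in which it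
   occurs. *)
Lemma prime_chain_monomials_free (T : finType) (e : T -> nat -> nat) (c : T -> K)
    (h : nat) (Q : nat -> {mpoly K[n]} -> Prop) (x : nat -> {mpoly K[n]}) :
    (forall i, (i <= h)%N -> is_prime_ideal (Q i)) ->
    (forall i, (i < h)%N -> [/\ forall f, Q i f -> Q i.+1 f,
      Q i.+1 (x i) & ~ Q i (x i)]) ->
  forall k i (A : {set T}), (i + k)%N = h -> A != set0 ->
    {in A, forall t, c t != 0} ->
    {in A &, forall s t,
       (forall j, (i <= j < h)%N -> e s j = e t j) -> s = t} ->
  ~ Q i (\sum_(t in A) c t *: \prod_(i <= j < h) x j ^+ e t j).
Proof.
move=> Qprime Qx; elim=> [|k IHk] i A.
  rewrite addn0 => -> /set0Pn[t tA] cA inj.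
  (* No exponents are left to compare, so [inj] leaves one term, a nonzero constant, which no prime
     contains. *)
  have -> : A = [set t].
    apply/setP=> s; rewrite inE; apply/idP/eqP=> [sA|-> //].
    by apply: inj => // j; rewrite ltnNge andbN.
  have [[_ _ QM] Q1 _] := Qprime h (leqnn h).
  rewrite big_set1 big_geq // => /(QM (c t)^-1%:MP).
  by rewrite mul_mpolyC scalerA mulVf ?scale1r // cA.
rewrite addnS => ikh /set0Pn[t0 t0A] cA inj.
have ih : (i < h)%N by rewrite -ikh ltnS leq_addr.
have [t1 t1A mint] := arg_minnP (fun t => e t i) t0A.
set l := e t1 i in mint.
have [Qsub Qxi nQxi] := Qx i ih.
have [_ _ QiM] := Qprime i (ltnW ih).
have [idQ Q1 _] := Qprime i.+1 ih; have [_ _ QM] := idQ.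
pose tl t := \prod_(i.+1 <= j < h) x j ^+ e t j.
rewrite (eq_bigr (fun t => x i ^+ l * (c t *: (x i ^+ (e t i - l) * tl t))))
  => [|t tA]; last first.
  rewrite big_ltn // -/(tl t) -scalerAr mulrA -exprD subnKC //; exact: mint.
rewrite -big_distrr /= => /QiM[/(prime_idealX (Qprime i (ltnW ih)))//|].
move/Qsub; rewrite (bigID (fun t => e t i == l)) /= => Qsum.
apply: (IHk i.+1 [set t in A | e t i == l]).
- by rewrite addSn.
- by apply/set0Pn; exists t1; rewrite inE eqxx andbT.
- by move=> t; rewrite inE => /andP[/cA].
- move=> s t; rewrite !inE => /andP[sA /eqP es] /andP[tA /eqP et] est.
  apply: inj => // j; rewrite leq_eqVlt => /andP[/predU1P[<- _|ij jh]].
    by rewrite es et.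
  by apply: est; rewrite ij.
rewrite (eq_bigl (fun t => (t \in A) && (e t i == l))) => [|t]; last by rewrite inE.
rewrite (eq_bigr (fun t => c t *: (x i ^+ (e t i - l) * tl t)))
  => [|t /andP[_ /eqP->]]; last by rewrite subnn mul1r.
set u := (X in X + _) in Qsum; set w := (X in _ + X) in Qsum.
suff: Q i.+1 u by [].
rewrite -[u](addrK w); apply: idealB => //; apply: ideal_sum => // t /andP[tA ne].
have lt : (l < e t i)%N by rewrite ltn_neqAle eq_sym ne mint.
rewrite -subnSK // exprSr -mul_mpolyC mulrAC mulrA; exact: QM.
Qed.

Lemma prime_chain_leq (P : {mpoly K[n]} -> Prop) h : prime_chain P h -> (h <= n)%N.
Proof.
case=> Q [Qprime Qsub _]; rewrite leqNgt; apply/negP=> nh.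
have /choice[x Qx] i : exists y, (i < h)%N -> Q i.+1 y /\ ~ Q i y.
  case: (ltnP i h) => [ih|]; last by exists 0.
  by have [_ [y]] := Qsub i ih; exists y.
have [N [c [t0 ct0] sum0]] := mpoly_alg_dep x.
(* Exponents are extended by 0 beyond [n]; only the first [n.+1] steps of the chain are used. *)
pose e (t : {ffun 'I_n.+1 -> 'I_N}) j : nat :=
  if insub j is Some j' then t j' else 0.
have eE (t : {ffun 'I_n.+1 -> 'I_N}) (j : 'I_n.+1) : e t j = t j by rewrite /e valK.
apply: (@prime_chain_monomials_free _ e c n.+1 Q x _ _ n.+1 0
  [set t | c t != 0]) => //.
- by move=> i ih; apply: Qprime; apply: leq_trans ih nh.
- move=> i /leq_trans/(_ nh) ih; have [Qi nQi] := Qx i ih.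
  by split=> //; have [] := Qsub i ih.
- by apply/set0Pn; exists t0; rewrite inE.
- by move=> t; rewrite inE.
- by move=> s t _ _ est; apply/ffunP=> j; apply: val_inj; have := est j (ltn_ord j); rewrite !eE.
have [[Q0 _ _] _ _] := Qprime 0%N (leq0n h).
rewrite -sum0 in Q0; congr (Q 0%N): Q0.
rewrite [RHS]big_mkcond; apply: eq_bigr => t _; rewrite inE big_mkord.
case: eqP => [->|_]; first by rewrite scale0r.
by congr (_ *: _); apply: eq_bigr => j _; rewrite eE.
Qed.

End Dimension.

(** * Height and big height as genuine maxima *)

Section Heights.

Variables (K : fieldType) (n : nat).
Implicit Types I P : {mpoly K[n]} -> Prop.

Lemma leq_height P h :
  is_prime_ideal P -> prime_chain P h -> h <= height P <= n.
Proof.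
move=> primeP Ph.
have [Pht maxht] := nat_maxP Ph (@prime_chain_leq K n P).
by rewrite maxht //=; apply: prime_chain_leq Pht.
Qed.

Lemma leq_height_bight I P : associated_prime I P -> height P <= bight I.
Proof.
move=> assP; pose H h := exists2 Q, associated_prime I Q & h = height Q.
have HP : H (height P) by exists P.
have Hn h : H h -> h <= n.
  case=> Q [primeQ _] ->.
  have Q0 : prime_chain Q 0 by exists (fun=> Q); split.
  by have /andP[] := leq_height primeQ Q0.
by have [_ ->] := nat_maxP HP Hn.
Qed.

End Heights.

(** * Edge and cover ideals of a graph *)

Section GraphIdeals.

Local Open Scope ring_scope.

Variables (K : fieldType) (n : nat) (E : {set {set 'I_n}}).
Implicit Types (C D e : {set 'I_n}).

Definition has_edge : pred {set 'I_n} := fun D => [exists e in E, e \subset D].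

Lemma vertex_coverP C :
  reflect {in E, forall e, meets e C} (vertex_cover E C).
Proof. exact: forall_inP. Qed.

Lemma vertex_cover_up : up_closed (vertex_cover E).
Proof.
move=> C D sCD /vertex_coverP coverC; apply/vertex_coverP => e eE.
exact: meets_up sCD (coverC e eE).
Qed.

Lemma cover_idealE :
  set_eq (cover_ideal K E) (support_ideal (vertex_cover E)).
Proof.
apply: support_ideal_gen => [|g [C /minsetp coverC ->]|D coverD].
- exact: vertex_cover_up.
- by exists C; rewrite ?mpolyX_mesym1.
have [C minC sCD] := minset_exists coverD.
by exists C => //; exists C; rewrite ?mpolyX_mesym1.
Qed.

Lemma edge_idealE : simple_graph E -> set_eq (edge_ideal K E) (support_ideal has_edge).
Proof.
move=> sE; apply: support_ideal_gen => [C D sCD|g [i [j [ijE ->]]]|D].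
- case/exists_inP=> e eE eC; apply/exists_inP; exists e => //.
  exact: subset_trans sCD.
- exists [set i; j]; first by apply/exists_inP; exists [set i; j].
  have ij : i != j by apply/eqP=> ij; have := sE _ ijE; rewrite ij setUid cards1.
  by rewrite mpolyX_mesym1 big_setU1 ?inE //= big_set1.
- case/exists_inP=> e eE eD; exists e => //.
  have /eqP/cards2P[i [j [ij eij]]] := sE _ eE.
  exists i, j; rewrite -eij; split=> //.
  by rewrite mpolyX_mesym1 eij big_setU1 ?inE //= big_set1.
Qed.

(** The prime is the colon by the product of the variables outside [C]: every edge has a vertex in
    [C], and by minimality each [i] in [C] is the only vertex in [C] of some edge. *)
Lemma min_cover_associated C : simple_graph E -> minset (vertex_cover E) C ->
  associated_prime (edge_ideal K E) (support_ideal (meets C)).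
Proof.
move=> sE /minsetP[/vertex_coverP coverC minC].
split; first exact: support_meets_prime.
exists 'X_[mesym1 (~: C)] => f.
have UC D : has_edge (D :|: ~: C) = meets C D.
  apply/exists_inP/meetsP=> [[e eE /subsetP eD] | [i iD iC]].
    have /meetsP[i iC ie] := coverC e eE; exists i => //.
    by have := eD i ie; rewrite !inE iC orbF.
  have /forall_inPn[e eE] : ~~ vertex_cover E (C :\ i).
    apply/negP=> /minC/(_ (subsetDl _ _))/setP/(_ i).
    by rewrite !inE iC eqxx.
  move/negbNE/eqP/setP=> e0; exists e => //; apply/subsetP=> j je.
  have := e0 j; rewrite !inE je andbT; case: eqP => [->|_ /= ->]; by rewrite ?iD ?orbT.
rewrite /colon; split.
  move/(edge_idealE sE)/support_ideal_mulX => Uf m mf.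
  by rewrite -UC -(mvars_mesym1 (~: C)) Uf.
move=> Cf; apply/(edge_idealE sE)/support_ideal_mulX => m mf.
by rewrite mvars_mesym1 UC Cf.
Qed.

Lemma min_cover_leq_bight C : simple_graph E -> minset (vertex_cover E) C ->
  (#|C| <= bight (edge_ideal K E))%N.
Proof.
move=> sE minC; apply: leq_trans (leq_height_bight (min_cover_associated sE minC)).
by have /andP[] := leq_height (support_meets_prime K C) (support_meets_chain K C).
Qed.

(* [P] contains both variables of some edge [e], so [x_i f] lies in the cover
   ideal for [i] in [e]; an edge other than [e] avoids one of these [i]. *)
Lemma cover_ideal_prime_colon f (P : {mpoly K[n]} -> Prop) :
    simple_graph E -> is_prime_ideal P ->
    set_eq (colon (cover_ideal K E) f) P ->
  exists2 e, e \in E & exists2 m, m \in msupp f &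
    forall e', e' \in E -> e' != e -> meets e' (mvars m).
Proof.
move=> sE primeP colonP; have [idP P1 _] := primeP; have [_ _ PM] := idP.
(* Otherwise the vertices whose variables are not in [P] form a cover [C]; then [X_C * f] is in the
   cover ideal, so [X_C] is in [P], against primality. *)
have /exists_inP[e eE /forall_inP eP] :
    [exists e in E, [forall i in e, excluded_middle_informative (P 'X_i)]].
  apply/contraT=> /exists_inPn noE; pose C := [set i | ~~ excluded_middle_informative (P 'X_i)].
  have coverC : vertex_cover E C.
    apply/vertex_coverP=> e /noE /forall_inPn[i ie nPi].
    by apply/meetsP; exists i; rewrite ?inE.
  have : P 'X_[mesym1 C].
    apply/colonP; rewrite /colon mulrC; apply/cover_idealE/support_ideal_mulX=> m _.
    rewrite mvars_mesym1; exact: vertex_cover_up (subsetUr _ _) coverC.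
  rewrite mpolyX_mesym1 => /(prime_ideal_prod primeP)[i].
  by rewrite inE; case: excluded_middle_informative.
have fP i m : i \in e -> m \in msupp f -> vertex_cover E (mvars m :|: [set i]).
  move=> ie mf; have /colonP : P 'X_i by move: (eP i ie); case: excluded_middle_informative.
  rewrite /colon mulrC => /cover_idealE/support_ideal_mulX/(_ m mf).
  by rewrite -mesym1_set1 mvars_mesym1.
(* If [f] were 0, the colon would contain 1. *)
have [m mf] : exists m, m \in msupp f.
  case E0 : (msupp f) => [|m s]; last by exists m; rewrite mem_head.
  case: P1; apply/colonP; rewrite /colon mul1r; apply/cover_idealE=> m.
  by rewrite E0.
exists e => //; exists m => // e' e'E ne.
have /subsetPn[i ie ie'] : ~~ (e \subset e').
  apply: contra ne => see'; rewrite eq_sym eqEcard see' /=.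
  by rewrite (sE _ eE) (sE _ e'E).
have /vertex_coverP/(_ _ e'E)/meetsP[j] := fP i m ie mf.
rewrite !inE => /orP[jm je'|/eqP-> ie2]; last by rewrite ie2 in ie'.
by apply/meetsP; exists j; rewrite ?inE.
Qed.

End GraphIdeals.

(** * Covers and almost covers of the cycle *)

Section Cycles.

Variable n : nat.
Implicit Types (C D S : {set 'I_n}) (i j k : 'I_n).

Lemma val_iter_ordS d i : val (iter d (@ordS n) i) = (i + d) %% n.
Proof.
elim: d => [|d IHd] /=; first by rewrite addn0 modn_small.
by rewrite IHd -addn1 modnDml addn1 addnS.
Qed.

Lemma iter_ordS_eq d i : (iter d (@ordS n) i == i) = (n %| d).
Proof.
rewrite -val_eqE /= val_iter_ordS -{2}(modn_small (ltn_ord i)).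
by rewrite -{2}[val i]addn0 eqn_modDl mod0n.
Qed.

Lemma mem_cycle_graph i : [set i; ordS i] \in cycle_graph n.
Proof. exact: imset_f. Qed.

Lemma cycle_coverP C :
  reflect (forall i, i \in C \/ ordS i \in C) (vertex_cover (cycle_graph n) C).
Proof.
apply: (iffP (vertex_coverP _ _)) => [coverC i | coverC _ /imsetP[i _ ->]].
  have /meetsP[j jC] := coverC _ (mem_cycle_graph i).
  by rewrite !inE => /orP[] /eqP <-; [left | right].
by apply/meetsP; case: (coverC i) => iC; [exists i | exists (ordS i)];
  rewrite ?inE ?eqxx ?orbT.
Qed.

(** If distinct [i] and [j] gave the same edge, each would succeed the other, so [n] would divide
    2. *)
Lemma cycle_edge_inj : 2 < n -> injective (fun i => [set i; ordS i]).
Proof.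
move=> n2 i j eij; apply/eqP; apply: contraTT (n2) => ij; rewrite -leqNgt.
have : i \in [set j; ordS j] by rewrite -eij !inE eqxx.
have : j \in [set i; ordS i] by rewrite eij !inE eqxx.
rewrite !inE (negbTE ij) eq_sym (negbTE ij) /= => /eqP ji /eqP ij'.
by apply: dvdn_leq => //; rewrite -(iter_ordS_eq 2 i) /= -ji -ij'.
Qed.

(** Inclusion-exclusion for [D] and its preimage under [ordS]; with [i] standing for the edge from
    [i] to [ordS i], it counts edges by their ends in [D]. *)
Lemma cards_cycle D :
  #|[set i | (i \in D) || (ordS i \in D)]| +
    #|[set i | (i \in D) && (ordS i \in D)]| = (#|D|).*2.
Proof.
rewrite -addnn -[X in _ = _ + X](card_preimset D (@ordS_inj n)) -[RHS]cardsUI.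
by congr (_ + _); apply: eq_card => i; rewrite !inE.
Qed.

Lemma cycle_almost_cover_card D i :
  (forall j, j != i -> j \in D \/ ordS j \in D) -> n <= (#|D|).*2.+1.
Proof.
move=> coverD; rewrite -cards_cycle.
have := cardsC1 i; rewrite card_ord => ci.
have : #|[set~ i]| <= #|[set i | (i \in D) || (ordS i \in D)]|.
  apply/subset_leq_card/subsetP=> j; rewrite !inE => /coverD.
  by case=> ->; rewrite ?orbT.
rewrite ci => le1; rewrite (leq_trans (leqSpred n)) // ltnS.
by apply: leq_trans le1 (leq_addr _ _).
Qed.

Lemma cycle_cover_card C : vertex_cover (cycle_graph n) C -> n <= (#|C|).*2.
Proof.
move/cycle_coverP=> coverC; rewrite -cards_cycle.
apply: leq_trans (leq_addr _ _).
rewrite -{1}(card_ord n) -cardsT subset_leq_card //.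
by apply/subsetP=> i _; rewrite inE; apply/orP.
Qed.

(** The edge with both ends in [C] is counted twice, which makes the inequality strict. *)
Lemma cycle_cover_edge_card C i : vertex_cover (cycle_graph n) C ->
  i \in C -> ordS i \in C -> n < (#|C|).*2.
Proof.
move=> /cycle_coverP coverC iC SiC; rewrite -cards_cycle -addn1 leq_add //.
  rewrite -{1}(card_ord n) -cardsT subset_leq_card //.
  by apply/subsetP=> j _; rewrite inE; apply/orP.
by rewrite card_gt0; apply/set0Pn; exists i; rewrite inE iC.
Qed.

(* A minimal cover avoiding [i] and [i + 3] contains the edge between them. *)
Lemma cycle_large_min_cover : 2 < n -> n <> 4 ->
  exists2 C, minset (vertex_cover (cycle_graph n)) C & n < (#|C|).*2.
Proof.
move=> n2 n4; pose i : 'I_n := Ordinal (ltn_trans (isT : 0 < 2) n2).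
(* An edge inside the set of [i] and [i + 3] would force [n] to divide 1, 2 or 4. For [n = 3] the
   two vertices coincide. *)
have ordS_neq d j : 0 < d <= 4 -> d != 3 -> iter d (@ordS n) j != j.
  rewrite iter_ordS_eq => /andP[d0 d4] d3; apply/negP=> nd.
  have nled := dvdn_leq d0 nd.
  have [d_eq4 n_eq3] : d = 4 /\ n = 3 by lia.
  by rewrite d_eq4 n_eq3 in nd.
have coverD : vertex_cover (cycle_graph n) (~: [set i; iter 3 (@ordS n) i]).
  apply/cycle_coverP=> j; apply/orP; rewrite !in_setC -negb_and !inE.
  have S1 := ordS_neq 1 _ isT isT; have S2 := ordS_neq 2 _ isT isT.
  have S4 := ordS_neq 4 _ isT isT.
  apply/negP=> /andP[/orP[] /eqP-> /orP[] /eqP] /eqP; apply/negP.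
  - exact: S1.
  - by rewrite eq_sym; apply: (S2 (ordS i)).
  - exact: S4.
  - exact: S1.
have [C minC /subsetP sCD] := minset_exists coverD.
have /cycle_coverP coverC := minsetp minC.
exists C => //; apply: (@cycle_cover_edge_card _ (ordS i)) (minsetp minC) _ _.
  by case: (coverC i) => // /sCD; rewrite !inE eqxx.
case: (coverC (ordS (ordS i))) => // /sCD; by rewrite !inE eqxx orbT.
Qed.

End Cycles.

(* The witness consists of the vertices [2, 4, 6, ...] and [n - 1]. *)
Lemma cycle_almost_cover n : 2 < n ->
  exists (i : 'I_n) (S : {set 'I_n}), [/\ #|S| = n %/ 2, i \notin S, ordS i \notin S &
    forall j, j != i -> j \in S \/ ordS j \in S].
Proof.
(* The cap at [p] takes effect only for even [n], where the last value would be [n] itself. *)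
case: n => // p p2; pose g (q : 'I_(p.+1 %/ 2)) : 'I_p.+1 := inord (minn q.*2.+2 p).
have gE q : g q = minn q.*2.+2 p :> nat by rewrite inordK // ltnS geq_minr.
have coverg (j : 'I_p.+1) : j != ord0 -> j \in g @: setT \/ ordS j \in g @: setT.
  move=> j0; have {}j0 : 0 < j by rewrite lt0n.
  have jp := ltn_ord j.
  (* For this index the capped value [2q + 2] is [j] or [j + 1], according to parity. *)
  have qp : j.-1 %/ 2 < p.+1 %/ 2 by lia.
  have gS : g (Ordinal qp) \in g @: setT by apply: imset_f.
  case: (eqVneq (g (Ordinal qp)) j) => [<-|ne]; first by left.
  right; suff <- : g (Ordinal qp) = ordS j by [].
  apply: val_inj; rewrite /= gE /=; move: ne; rewrite -val_eqE /= gE /= => /eqP.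
  move=> ne; rewrite modn_small; lia.
have small (j : 'I_p.+1) : j < 2 -> j \notin g @: setT.
  by move=> j2; apply/imsetP=> -[q _ jq]; move: j2; rewrite jq gE; lia.
have S0 : ordS (@ord0 p) \notin g @: setT by apply: small; rewrite /= modn_small; lia.
exists ord0, (g @: setT); split=> //; last exact: small.
(* The size of an image bounds the cardinality above and almost covering bounds it below; the bounds
   agree, so injectivity of [g] is not proved separately. *)
have := cycle_almost_cover_card coverg.
have := leq_imset_card g setT; rewrite cardsT card_ord.
set c := #|_|; lia.
Qed.

(** * The v-number of the cover ideal of a cycle *)

Lemma v_number_cycle (K : fieldType) n : 2 < n ->
  v_number (cover_ideal K (cycle_graph n)) = n %/ 2.
Proof.
move=> n2; have simpleC := cycle_graph_simple n2.
apply: nat_minP => [|d [f [P [/dhomogP homf [primeP _] colonP]]]].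
  have [i [S [cardS iS SiS coverS]]] := cycle_almost_cover n2.
  pose e := [set i; ordS i].
  have colonS : set_eq (colon (cover_ideal K (cycle_graph n)) 'X_[mesym1 S])
                       (support_ideal (meets e)).
    (* [S] misses both ends of [e] and covers every other edge, so only [e] remains for [D] to
       cover. *)
    have US D : vertex_cover (cycle_graph n) (D :|: S) = meets e D.
      apply/cycle_coverP/meetsP => [/(_ i) coverD | [k kD ke] j].
        have : (i \in D) || (ordS i \in D).
          by apply/orP; move: coverD; rewrite !inE (negbTE iS) (negbTE SiS) !orbF.
        by case/orP=> iD; [exists i | exists (ordS i)]; rewrite // !inE eqxx ?orbT.
      case: (eqVneq j i) => [->|/coverS]; last first.
        by rewrite !inE => -[] ->; rewrite orbT; [left | right].
      by move: ke; rewrite !inE => /orP[] /eqP <-; rewrite kD; [left | right].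
    move=> f; rewrite /colon; split.
      move/cover_idealE/support_ideal_mulX => Uf m mf.
      by rewrite -US -(mvars_mesym1 S) Uf.
    move=> ef; apply/cover_idealE/support_ideal_mulX => m mf.
    by rewrite mvars_mesym1 US ef.
  exists 'X_[mesym1 S], (support_ideal (meets e)); split=> //.
    by rewrite dhomogX /= mdeg_mesym1 cardS.
  split; first exact: support_meets_prime.
  by exists 'X_[mesym1 S].
have [e /imsetP[i _ ->] [m mf coverm]] := cover_ideal_prime_colon simpleC primeP colonP.
have : n <= (#|mvars m|).*2.+1.
  apply: (@cycle_almost_cover_card _ _ i) => j ji.
  have /meetsP[k km] : meets [set j; ordS j] (mvars m).
    apply: coverm; first exact: mem_cycle_graph.
    by apply: contra ji => /eqP/(cycle_edge_inj n2)->.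
  by rewrite in_set2 => /orP[] /eqP <-; [left | right].
have := leq_card_mvars m; rewrite (homf m mf); lia.
Qed.

Theorem proposition3p3 (K : fieldType) (n : nat) (hn : 3 <= n) :
  [/\ v_number (cover_ideal K (cycle_graph n)) = n %/ 2,
      v_number (cover_ideal K (cycle_graph n)) <= alpha0 (cycle_graph n)
    & n <> 4 ->
      v_number (cover_ideal K (cycle_graph n))
        <= bight (edge_ideal K (cycle_graph n)) - 1].
Proof.
rewrite v_number_cycle //; split=> // [|n4].
  rewrite /alpha0; case: arg_minnP => [|C coverC _].
    exact/vertex_coverT/cycle_graph_simple.
  by have := cycle_cover_card coverC; lia.
have [C minC ltC] := cycle_large_min_cover hn n4.
(* From [n < 2 * #|C|] follows [n %/ 2 < #|C|], which yields the subtracted 1. *)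
have := min_cover_leq_bight K (cycle_graph_simple hn) minC; lia.
Qed.
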